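(* Let $n\ge3$ be an integer, let $J\subset(0,\infty)$ be a non-degenerate interval and let $f\colon J\to J$ be a continuous function satisfying $$f^n(x)=\frac{[f(x)]^n}{x^{n-1}}\quad\text{for all }x\in J.$$ (i) If $J$ is bounded and $0\notin\mathrm{cl}\,J$, then $f(x)=x$ for every $x\in J$. (ii) If $J$ is bounded and $0\in\mathrm{cl}\,J$, then there exists $c\in(0,1]$ such that $f(x)=cx$ for every $x\in J$. (iii) If $J$ is unbounded and $0\notin\mathrm{cl}\,J$, then there exists $c\in[1,\infty)$ such that $f(x)=cx$ for every $x\in J$. (iv) If $J=(0,\infty)$ and $n$ is even, then there exists $c\in(0,\infty)$ such that $f(x)=cx$ for every $x\in J$. (v) If $J=(0,\infty)$ and $n$ is odd, then there exists $c\in(0,\infty)$ such that either $f(x)=cx$ for every $x\in(0,\infty)$, or $f(x)=cx^{r_0}$ for every $x\in(0,\infty)$, where $r_0$ is the negative root of the equation $r^n=nr-n+1$.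
   Context: $f^n$ denotes the $n$-th iterate of $f$, whereas $[f(x)]^n$ is the $n$-th power of the value $f(x)$. $\mathrm{cl}\,J$ is the closure of $J$ in $\mathbb R$. For odd $n\ge3$ the equation $r^n=nr-n+1$ has exactly one real root other than $1$, and this root is negative; it is denoted by $r_0$. *)

(* Defs.v *)
From HB Require Import structures.
From mathcomp Require Import all_boot all_order all_algebra.
From mathcomp Require Import all_classical all_reals all_analysis.

Set Implicit Arguments.
Unset Strict Implicit.
Unset Printing Implicit Defensive.

Import Order.TTheory GRing.Theory Num.Theory.
Import numFieldNormedType.Exports.

Local Open Scope classical_set_scope.
Local Open Scope ring_scope.

(* For odd n >= 3 the set below is a singleton; [get] picks its element, and
   returns an arbitrary real if the set is empty (e.g. for even n). *)
Definition neg_root (R : realType) (n : nat) : R :=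
  get [set r : R | r < 0 /\ r ^+ n = n%:R * r - n%:R + 1].

(* Main.v *)
(** In logarithmic coordinates the equation reads [g^n t = n g(t) - (n-1) t], so
    [g] is injective, hence strictly monotone, and every orbit [a_k] satisfies
    [a_(k+n) = n a_(k+1) - (n-1) a_k].

    Key fact: a nonnegative sequence, each term of which is a fixed convex
    combination of the next [m] terms with positive weights on the last two, is
    constant.  Indeed a suitable weighted sum over a window of length [m] does
    not depend on the window, and a term close to the infimum forces a whole
    later window to be close to it.

    If [g] is increasing, the increments of an orbit have constant sign and each
    is the mean of the next [n-1], so orbits are arithmetic progressions; by
    monotonicity and continuity the common difference is the same for all of
    them, and [g] is a translation.

    If [g] is decreasing with fixed point [p], the differences [a_k - p]
    alternate in sign.  This rules out even [n]; for odd [n] they at least double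
    in size every [n] steps, so the interval is the whole line and [g] is onto.
    Along a backward orbit [s_k], the sequence [r_0^k (s_k - p)] has constant
    sign and satisfies a convex recurrence, hence is constant, and [g] is affine
    of slope [r_0]. *)

Require Import Defs.
From HB Require Import structures.
From mathcomp Require Import all_boot all_order all_algebra.
From mathcomp Require Import all_classical all_reals all_analysis.
From mathcomp Require Import ring lra zify.

Set Implicit Arguments.
Unset Strict Implicit.
Unset Printing Implicit Defensive.

Import Order.TTheory GRing.Theory Num.Theory.
Import numFieldNormedType.Exports.

Local Open Scope classical_set_scope.
Local Open Scope ring_scope.

(** * Nonnegative sequences satisfying a convex recurrence *)

Section averaging.
Context {R : realType} (N : nat).
Implicit Types c y : nat -> R.

Lemma averaging_inf0 c y :
  (forall j, 0 <= c j) -> \sum_(j < N.+2) c j = 1 -> 0 < c N -> 0 < c N.+1 ->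
  (forall k, 0 <= y k) ->
  (forall k, y k = \sum_(j < N.+2) c j * y (k + j.+1)%N) ->
  (forall e, 0 < e -> exists k, y k < e) ->
  forall k, y k = 0.
Proof.
move=> c0 c1 cN cSN y0 yE yinf.
(* Tail sums of the weights: since [T j = c j + T j.+1] on the window, expanding the first term
   [y k] of [L k] by the recurrence yields [L k.+1]. *)
pose T j := \sum_(j <= i < N.+2) c i.
have T0 j : 0 <= T j by apply: sumr_ge0.
have T00 : T 0%N = 1 by rewrite /T big_mkord.
have TN : T N.+1 = c N.+1 by rewrite /T big_nat1.
pose L k := \sum_(j < N.+2) T j * y (k + j)%N.
have LS k : L k.+1 = L k.
  rewrite /L [RHS]big_ord_recl /= addn0 T00 mul1r yE.
  rewrite (big_ord_recr N.+1) /= [\sum_(j < N.+2) c j * _]big_ord_recr /=.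
  rewrite TN addSnnS addrAC; congr (_ + _).
  rewrite -big_split /=; apply: eq_bigr => j _.
  rewrite /bump /= add1n addSnnS -mulrDl; congr (_ * _).
  by rewrite /T big_ltn // ltnS ltnW.
have LE k : L k = L 0%N by elim: k => // k IH; rewrite LS.
have yL k : y k <= L 0%N.
  rewrite -(LE k) /L big_ord_recl /= addn0 T00 mul1r lerDl.
  by apply: sumr_ge0 => j _; rewrite mulr_ge0.
pose q := Num.min (c N) (c N.+1).
have q0 : 0 < q by rewrite lt_min cN cSN.
have step k : q * y (k + N.+1)%N <= y k /\ q * y (k + N.+2)%N <= y k.
  rewrite [X in _ <= X /\ _]yE [X in _ /\ _ <= X]yE !big_ord_recr /=.
  have ? : 0 <= \sum_(i < N) c i * y (k + i.+1)%N.
    by apply: sumr_ge0 => j _; rewrite mulr_ge0.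
  have ? : q * y (k + N.+1)%N <= c N * y (k + N.+1)%N.
    by rewrite ler_wpM2r // ge_min lexx.
  have ? : q * y (k + N.+2)%N <= c N.+1 * y (k + N.+2)%N.
    by rewrite ler_wpM2r // ge_min lexx orbT.
  have ? : 0 <= c N * y (k + N.+1)%N by rewrite mulr_ge0.
  have ? : 0 <= c N.+1 * y (k + N.+2)%N by rewrite mulr_ge0.
  by split; lra.
(* Make [m] jumps of length [N.+1] or [N.+2], exactly [j] of them long; each jump costs a factor
   [q]. *)
have prop m k j : (j <= m)%N -> q ^+ m * y (k + m * N.+1 + j)%N <= y k.
  elim: m k j => [|m IH] k j.
    by rewrite leqn0 => /eqP->; rewrite mul0n !addn0 mul1r.
  have [s1 s2] := step k.
  case: j => [_|j jm].
    apply: le_trans s1; rewrite exprS -mulrA ler_pM2l //.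
    by have := IH (k + N.+1)%N 0%N (leq0n m); rewrite mulSn !addnA.
  apply: le_trans s2; rewrite exprS -mulrA ler_pM2l //.
  have := IH (k + N.+2)%N j jm.
  by rewrite (_ : k + N.+2 + _ + j = k + m.+1 * N.+1 + j.+1)%N //; lia.
pose C := \sum_(j < N.+2) T j / q ^+ N.+1.
have qN : 0 < q ^+ N.+1 by rewrite exprn_gt0.
(* After [N.+1] jumps the reachable indices fill [N.+2] consecutive places, a whole window, so a
   small [y k] makes the invariant [L] small. *)
have LC k : L 0%N <= C * y k.
  rewrite -(LE (k + N.+1 * N.+1)%N) /L /C mulr_suml; apply: ler_sum => j _.
  rewrite -mulrA ler_wpM2l // mulrC ler_pdivlMr // mulrC.
  by apply: prop; rewrite -ltnS.
have C0 : 0 <= C by apply: sumr_ge0 => j _; rewrite divr_ge0 // ltW.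
have L0 : L 0%N <= 0.
  apply/ler_addgt0Pl => e e0; rewrite addr0.
  have [k yk] := yinf (e / (C + 1)) (divr_gt0 e0 (ltr_wpDl C0 ltr01)).
  apply: le_trans (LC k) _; move: yk; rewrite ltr_pdivlMr ?ltr_wpDl // => yk.
  have := y0 k; nra.
by move=> k; apply/eqP; rewrite eq_le y0 (le_trans (yL k)).
Qed.

(* Subtracting the infimum reduces to [averaging_inf0]. *)
Lemma averaging_const c y :
  (forall j, 0 <= c j) -> \sum_(j < N.+2) c j = 1 -> 0 < c N -> 0 < c N.+1 ->
  (forall k, 0 <= y k) ->
  (forall k, y k = \sum_(j < N.+2) c j * y (k + j.+1)%N) ->
  forall k, y k = y 0%N.
Proof.
move=> c0 c1 cN cSN y0 yE.
have ylb : has_inf (range y).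
  by split; [exists (y 0%N), 0%N|exists 0 => _ [k _ <-]].
have H : forall k, y k - inf (range y) = 0.
  apply: (averaging_inf0 c0 c1 cN cSN) => [k|k|e e0].
  - by rewrite subr_ge0; apply: ge_inf; [case: ylb|exists k].
  - rewrite yE -[in LHS](mul1r (inf _)) -c1 mulr_suml -sumrB.
    by apply: eq_bigr => j _; rewrite mulrBr.
  - have [_ [k _ <-] yk] := inf_adherent e0 ylb.
    by exists k; rewrite ltrBlDl.
by move=> k; rewrite -[LHS](subrK (inf (range y))) -[RHS](subrK (inf (range y))) !H.
Qed.

End averaging.

(** * Orbit recurrences reduced to convex ones, with [n = N.+3] *)

Section recurrences.
Context {R : realType} (N : nat).
Implicit Types a z : nat -> R.

(* The increments [d] satisfy [(n - 1) d_k = d_(k+1) + ... + d_(k+n-1)]. *)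
Lemma nondecreasing_arith a :
  (forall k, a (k + N.+3)%N = N.+3%:R * a k.+1 - N.+2%:R * a k) ->
  (forall k, a k <= a k.+1) ->
  forall k, a k = a 0%N + k%:R * (a 1%N - a 0%N).
Proof.
move=> aE amono.
have N2 : (N.+2%:R : R) != 0 by rewrite pnatr_eq0.
have N2V : (0 : R) < N.+2%:R^-1 by rewrite invr_gt0.
have dE : forall k, a k.+1 - a k = a 1%N - a 0%N.
  apply: (@averaging_const _ N (fun=> N.+2%:R^-1)) => [_||||k|k].
  - exact: ltW.
  - by rewrite sumr_const card_ord -[LHS]mulr_natl mulfV.
  - by [].
  - by [].
  - by rewrite subr_ge0.
  (* Multiplied by [n - 1], the mean of the increments telescopes to [a (k + n) - a (k + 1)], which
     the recurrence evaluates. *)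
  rewrite -mulr_sumr; apply: (mulfI N2); rewrite mulVKf //.
  rewrite (eq_bigr (fun j : 'I_N.+2 => a (k.+1 + j).+1 - a (k.+1 + j)%N)); last first.
    by move=> j _; rewrite addSnnS.
  rewrite -(big_mkord xpredT (fun j => a (k.+1 + j).+1 - a (k.+1 + j)%N)).
  under eq_bigr do rewrite -addnS.
  rewrite (telescope_sumr (fun j => a (k.+1 + j)%N)) // addn0 addSnnS aE.
  by rewrite [N.+3%:R]mulrSr; ring.
elim=> [|k IH]; first by rewrite mul0r addr0.
by rewrite -(subrK (a k) (a k.+1)) dE IH -[k.+1]addn1 natrD; ring.
Qed.

Lemma nonincreasing_arith a :
  (forall k, a (k + N.+3)%N = N.+3%:R * a k.+1 - N.+2%:R * a k) ->
  (forall k, a k.+1 <= a k) ->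
  forall k, a k = a 0%N + k%:R * (a 1%N - a 0%N).
Proof.
move=> aE amono k.
have := @nondecreasing_arith (fun j => - a j).
move=> /(_ _ _ k) H; apply: oppr_inj; rewrite {}H => [|j|j].
- by ring.
- by rewrite aE; ring.
- by rewrite lerN2.
Qed.

(* [l ^ k * z_k] is an averaging sequence since [l ^ n = n l + n - 1]. *)
Lemma backward_geom (l : R) z :
  0 < l -> l ^+ N.+3 = N.+3%:R * l + N.+2%:R -> (forall k, 0 <= z k) ->
  (forall k, z k = N.+3%:R * z (k + N.+2)%N + N.+2%:R * z (k + N.+3)%N) ->
  z 0%N = l * z 1%N.
Proof.
move=> l0 lE z0 zE.
(* Index [j] weighs the term at distance [j.+1], so the weights sit at distances [n - 1] and [n];
   their sum is [(n l + n - 1) / l ^ n = 1]. *)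
pose c (j : nat) : R := if j == N.+1 then N.+3%:R / l ^+ N.+2 else
            if j == N.+2 then N.+2%:R / l ^+ N.+3 else 0.
have sumc (F : nat -> R) : \sum_(j < N.+3) c j * F j =
    N.+3%:R / l ^+ N.+2 * F N.+1 + N.+2%:R / l ^+ N.+3 * F N.+2.
  rewrite 2!big_ord_recr big1 /= => [|j _]; last first.
    have jN := ltn_ord j; have jN' : (j < N.+2)%N := ltnW jN.
    by rewrite /c (ltn_eqF jN) (ltn_eqF jN') mul0r.
  by rewrite /c !eqxx (gtn_eqF (ltnSn N.+1)) add0r.
have lX k : 0 < l ^+ k by rewrite exprn_gt0.
have lN0 : l != 0 by rewrite gt_eqF.
suff /(_ 1%N) : forall k, l ^+ k * z k = l ^+ 0 * z 0%N.
  by rewrite expr0 mul1r expr1.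
apply: (@averaging_const _ N.+1 c (fun k => l ^+ k * z k)).
- by move=> j; rewrite /c; do 2?case: ifP => _ //; rewrite divr_ge0 // ltW.
- under eq_bigr do rewrite -[c _]mulr1.
  rewrite (sumc (fun=> 1)) !mulr1.
  have -> : N.+3%:R = (l ^+ N.+3 - N.+2%:R) / l by rewrite lE; field.
  by rewrite exprS; field; rewrite !gt_eqF.
- by rewrite /c eqxx divr_gt0.
- by rewrite /c eqxx (gtn_eqF (ltnSn N.+1)) divr_gt0.
- by move=> k; rewrite mulr_ge0 // ltW.
- move=> k; rewrite (sumc (fun j => l ^+ (k + j.+1) * z (k + j.+1)%N)) zE !exprD.
  by field; rewrite !gt_eqF.
Qed.

End recurrences.

(** * Archimedean property, alternating signs and the negative root *)

Lemma archimedean_multiple {R : realType} (M e : R) :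
  0 < e -> exists k : nat, M < k%:R * e.
Proof.
move=> e0; exists (Num.bound (`|M| / e)).
rewrite -ltr_pdivrMr //; apply: le_lt_trans (archi_boundP _).
- by rewrite ler_pM2r ?invr_gt0 // ler_norm.
- by rewrite divr_ge0 // ltW.
Qed.

(** The expressions for [k] and [k.+1] have as product minus a nonzero square times [s k * s k.+1],
    so positivity propagates. *)
Lemma alternating_sign {R : realType} (s : nat -> R) :
  (forall k, s k * s k.+1 < 0) -> forall k, 0 < s 0%N * ((-1) ^+ k * s k).
Proof.
move=> sN; have s_neq0 k : s k != 0.
  by apply/eqP => s0; have := sN k; rewrite s0 mul0r ltxx.
elim=> [|k IH]; first by rewrite expr0 mul1r -expr2 exprn_even_gt0 //= s_neq0.
rewrite -(pmulr_rgt0 _ IH).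
have -> : s 0%N * ((-1) ^+ k * s k) * (s 0%N * ((-1) ^+ k.+1 * s k.+1)) =
    - (((-1) ^+ k * s 0%N) ^+ 2 * (s k * s k.+1)) by rewrite exprS; ring.
rewrite oppr_gt0 pmulr_rlt0 // exprn_even_gt0 //= mulf_neq0 ?s_neq0 //.
by rewrite signr_eq0.
Qed.

(** The set defining [neg_root] is inhabited, by the intermediate value theorem, so [get] returns a
    genuine root. *)
Lemma neg_rootP {R : realType} (n : nat) : (3 <= n)%N -> odd n ->
  neg_root R n < 0 /\ neg_root R n ^+ n = n%:R * neg_root R n - n%:R + 1.
Proof.
move=> n3 nodd.
suff: exists r : R, r < 0 /\ r ^+ n = n%:R * r - n%:R + 1 by move=> /getPex.
have n1 : (1 : R) < n%:R by rewrite ltr1n; lia.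
(* For odd [n] this is the equation in the variable [x = - r], to be solved on [[0, 2]]. *)
pose p : {poly R} := 'X^n - n%:R *: 'X - (n%:R - 1)%:P.
have pE x : p.[x] = x ^+ n - n%:R * x - (n%:R - 1) by rewrite /p !hornerE.
have p0 : p.[0] = 1 - n%:R by rewrite pE expr0n gtn_eqF ?(ltnW (ltnW n3)) //=; ring.
have p2 : 0 <= p.[2].
  (* This says [p(2) >= 0]; equality holds at [n = 3]. *)
  have : (3 * n <= 2 ^ n + 1)%N.
    elim: n n3 {nodd n1 p pE p0} => // n IH.
    rewrite leq_eqVlt => /orP[/eqP<- //|n4].
    have := IH n4; rewrite expnS; lia.
  by rewrite pE -(ler_nat R) natrD natrM natrX; lra.
have : p.[0] <= 0 <= p.[2] by rewrite p2 p0 subr_le0 ltW.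
move=> /(poly_ivt (ler0n R 2))[x /andP[x0 _] /rootP].
rewrite pE => px; exists (- x); split.
  rewrite oppr_lt0 lt_neqAle x0 andbT; apply/eqP => xE.
  by move: p0; rewrite pE xE px; lra.
by rewrite exprNn -signr_odd nodd expr1; lra.
Qed.

(** * The additive iterative equation on an interval *)

Section iterates.
Context {R : realType} (N : nat) (I : set R) (g : R -> R).
Hypothesis I_itv : is_interval I.
Hypothesis g_I : set_fun I I g.
Hypothesis g_cont : {within I, continuous g}.
Hypothesis g_iter :
  forall t, I t -> iter N.+3 g t = N.+3%:R * g t - N.+2%:R * t.

Let sub_itv x y : I x -> I y -> `[x, y] `<=` I.
Proof. by move=> Ix Iy z; rewrite /= in_itv /=; exact: I_itv. Qed.

Let iter_I k t : I t -> I (iter k g t).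
Proof. by move=> It; elim: k => //= k; exact: g_I. Qed.

Let orbit_rec k t : I t ->
  iter (k + N.+3) g t = N.+3%:R * iter k.+1 g t - N.+2%:R * iter k g t.
Proof. by move=> It; rewrite addnC iterD g_iter //; exact: iter_I. Qed.

(** Equal values force equal [n]-th iterates, and the equation then leaves
    [(n - 1) s = (n - 1) t]. *)
Let g_inj s t : I s -> I t -> g s = g t -> s = t.
Proof.
move=> Is It st.
have : iter N.+3 g s = iter N.+3 g t by rewrite !iterSr st.
rewrite !g_iter // st => /addrI/oppr_inj/mulfI; apply.
by rewrite pnatr_eq0.
Qed.

Lemma iterates_monotone :
  (forall s t, I s -> I t -> s < t -> g s < g t) \/
  (forall s t, I s -> I t -> s < t -> g t < g s).
Proof.
have IE := (is_intervalP I).1 I_itv.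
have II z : I z -> z \in Rhull I by rewrite {1}IE.
have [] := @itv_continuous_inj_mono _ g (Rhull I).
- by rewrite -IE.
- by move=> s t; rewrite -!topredE /= => Is It; apply: g_inj; rewrite IE.
- by move=> gm; left => s t /II Is /II It; exact: gm.
- by move=> gm; right => s t /II Is /II It; exact: gm.
Qed.

(** * Increasing solutions are translations *)

Section increasing.
Hypothesis g_incr : forall s t, I s -> I t -> s < t -> g s < g t.

Let d t := g t - t.

Let g_le s t : I s -> I t -> s <= t -> g s <= g t.
Proof.
by move=> Is It; rewrite le_eqVlt => /predU1P[->//|st]; exact/ltW/g_incr.
Qed.

(** Monotonicity of [g] carries the sign of the first increment along the whole orbit. *)
Let orbit_arith k t : I t -> iter k g t = t + k%:R * d t.
Proof.
move=> It; have [tg|gt] := leP t (g t).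
- apply: (@nondecreasing_arith _ N (fun k => iter k g t)) => j.
    exact: orbit_rec.
  by elim: j => //= j IH; apply: g_le => //; do ?apply: g_I; exact: iter_I.
- apply: (@nonincreasing_arith _ N (fun k => iter k g t)) => j.
    exact: orbit_rec.
  by elim: j => [|j IH] /=; [exact: ltW|apply: g_le => //; do ?apply: g_I; exact: iter_I].
Qed.

Let d_orbit k t : I t -> d (iter k g t) = d t.
Proof.
by move=> It; rewrite /d -iterS !orbit_arith // -[k.+1]addn1 natrD /d; ring.
Qed.

Let orbit_lt k s t : I s -> I t -> s < t -> iter k g s < iter k g t.
Proof. by move=> Is It st; elim: k => //= k; apply: g_incr; exact: iter_I. Qed.

(** Orbits keep their order; were [d s > d t], the progression from [s] would overtake the one from
    [t]. *)
Let d_le s t : I s -> I t -> s <= t -> d s <= d t.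
Proof.
move=> Is It; rewrite le_eqVlt => /predU1P[->//|st].
rewrite leNgt; apply/negP; rewrite -subr_gt0 => /(archimedean_multiple (t - s))[k].
have := orbit_lt k Is It st; rewrite !orbit_arith //; lra.
Qed.

(* The orbit of the endpoint moving towards the other one eventually overtakes
   it, which reverses the inequality of [d_le]. *)
Let d_sign s t : I s -> I t -> s < t -> d s < d t -> d s <= 0 <= d t.
Proof.
move=> Is It st dst; apply/andP; split; rewrite leNgt; apply/negP => d0.
- have [k kd] := archimedean_multiple (t - s) d0.
  have : t <= iter k g s by rewrite orbit_arith //; lra.
  move=> /(d_le It (iter_I k Is)); rewrite d_orbit //; lra.
- have [k kd] : exists k : nat, t - s < k%:R * - d t.
    by apply: archimedean_multiple; lra.
  have : iter k g t <= s by rewrite orbit_arith //; lra.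
  move=> /(d_le (iter_I k It) Is); rewrite d_orbit //; lra.
Qed.

Let d_IVT s t v : I s -> I t -> s < t -> d s <= v <= d t ->
  exists2 u, s <= u <= t & d u = v.
Proof.
move=> Is It st sv; have dst := d_le Is It (ltW st).
have [|||u] := @IVT _ d s t v; first exact: ltW.
- apply: within_continuousB; last by apply: continuous_subspaceT => ?; exact: cvg_id.
  exact: continuous_subspaceW (sub_itv Is It) g_cont.
- by rewrite min_l // max_r.
by rewrite in_itv /= => ? ?; exists u.
Qed.

(** Otherwise one of [d s < 0] and [d t > 0] holds. Halving that value gives an intermediate value
    of the same sign, which contradicts [d_sign] on a subinterval. *)
Let d_const s t : I s -> I t -> s < t -> d s = d t.
Proof.
move=> Is It st; apply/eqP; rewrite eq_le d_le ?(ltW st) //= leNgt.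
apply/negP => dst; have /andP[ds dt] := d_sign Is It st dst.
have [ds0|ds0] := ltP (d s) 0.
- have [|u /andP[su ut] du] := @d_IVT s t (d s / 2) Is It st; first lra.
  have Iu : I u by apply: (I_itv Is It); rewrite su.
  have {}su : s < u by rewrite lt_neqAle su andbT; apply/eqP => E; subst u; lra.
  by have := d_sign Is Iu su; lra.
- have [|u /andP[su ut] du] := @d_IVT s t (d t / 2) Is It st; first lra.
  have Iu : I u by apply: (I_itv Is It); rewrite su.
  have {}ut : u < t by rewrite lt_neqAle ut andbT; apply/eqP => E; subst u; lra.
  by have := d_sign Iu It ut; lra.
Qed.

Lemma increasing_translation : exists c, forall t, I t -> g t = t + c.
Proof.
have [[t0 It0]|I0] := pselect (exists t, I t); last first.
  by exists 0 => t It; exfalso; apply: I0; exists t.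
exists (d t0) => t It; suff <- : d t = d t0 by rewrite /d addrC subrK.
by have [/d_const|/d_const ->|->] := ltgtP t t0; rewrite // => ->.
Qed.

End increasing.

(** * Decreasing solutions are affine of slope [r_0] *)

Section decreasing.
Hypothesis I_nondeg : exists x y, [/\ I x, I y & x < y].
Hypothesis g_decr : forall s t, I s -> I t -> s < t -> g t < g s.

(** As [g] decreases, [x < g x] implies [g (g x) < g x], and symmetrically; hence [g - id] changes
    sign between [x] and [g x]. *)
Let fixpoint : exists2 p, I p & g p = p.
Proof.
have [x [_ [Ix _ _]]] := I_nondeg.
have crossing a b : I a -> I b -> a < b -> a <= g a -> g b <= b ->
    exists2 p, I p & g p = p.
  move=> Ia Ib ab ga gb.
  have [|||p] := @IVT _ (g - id) a b 0; first exact: ltW.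
  - apply: within_continuousB; last by apply: continuous_subspaceT => ?; exact: cvg_id.
    exact: continuous_subspaceW (sub_itv Ia Ib) g_cont.
  - by rewrite ge_min le_max !fctE /= !subr_le0 !subr_ge0 ga gb orbT.
  rewrite in_itv /= => /(I_itv Ia Ib) Ip /eqP.
  by rewrite subr_eq0 => /eqP gp; exists p.
have Igx := g_I Ix; have [xg|gx|xE] := ltgtP x (g x); last by exists x.
- exact: (crossing _ _ Ix Igx xg (ltW xg) (ltW (g_decr Ix Igx xg))).
- exact: (crossing _ _ Igx Ix gx (ltW (g_decr Igx Ix gx)) (ltW gx)).
Qed.

Section fixed_point.
Variable p : R.
Hypothesis Ip : I p.
Hypothesis gp : g p = p.

Let cross t : I t -> t != p -> (t - p) * (g t - p) < 0.
Proof.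
move=> It; rewrite neq_lt => /orP[tp|pt].
- by rewrite nmulr_rlt0 ?subr_lt0 // subr_gt0 -[ltLHS]gp; exact: g_decr.
- by rewrite pmulr_rlt0 ?subr_gt0 // subr_lt0 -[ltRHS]gp; exact: g_decr.
Qed.

Let iter_neq k t : I t -> t != p -> iter k g t != p.
Proof.
move=> It tp; elim: k => //= k IH.
have := cross (iter_I k It) IH.
by case: (eqVneq (g _) p) => // ->; rewrite subrr mulr0 ltxx.
Qed.

Let orbit_sign k t : I t -> t != p ->
  0 < (t - p) * ((-1) ^+ k * (iter k g t - p)).
Proof.
move=> It tp; apply: (@alternating_sign _ (fun k => iter k g t - p)) => j.
by rewrite /=; apply: cross; [exact: iter_I|exact: iter_neq].
Qed.

Let exists_gt : exists2 t, I t & p < t.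
Proof.
have [x [y [Ix Iy xy]]] := I_nondeg.
have [px|xp] := ltP p x; first by exists x.
have [py|yp] := ltP p y; first by exists y.
by exists (g x); [exact: g_I|rewrite -[ltLHS]gp; apply: g_decr; rewrite // (lt_le_trans xy)].
Qed.

(** For even [n] the [n]-th iterate of some [t > p] would exceed [p], yet [g t < p < t] makes
    [n g(t) - (n - 1) t] smaller than [g t]. *)
Lemma decreasing_odd : odd N.+3.
Proof.
have [t It pt] := exists_gt; have [//|nodd] := boolP (odd N.+3); exfalso.
have tp : t != p by rewrite gt_eqF.
have := orbit_sign N.+3 It tp; have := orbit_sign 1 It tp.
move: nodd; rewrite -[(-1) ^+ N.+3]signr_odd => /negbTE->.
rewrite expr0 mul1r expr1 g_iter //=.
have tp0 : 0 < t - p by rewrite subr_gt0.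
rewrite !(pmulr_rgt0 _ tp0) [N.+3%:R]mulrSr => gt_p.
have : 0 < N.+2%:R * (t - g t) by apply: mulr_gt0 => //; lra.
lra.
Qed.

(** The distances [z k] to [p] satisfy [z (k + n) = n z (k + 1) + (n - 1) z k] for odd [n], so they
    at least double every [n] steps. *)
Let orbit_unbounded v : (exists2 x, I x & v <= g x) /\ (exists2 y, I y & g y <= v).
Proof.
have [t It pt] := exists_gt.
have tp : t != p by rewrite gt_eqF.
have tp0 : 0 < t - p by rewrite subr_gt0.
have odd3 := decreasing_odd.
pose z k := (-1) ^+ k * (iter k g t - p).
have z0 k : 0 < z k by rewrite -(pmulr_rgt0 _ tp0); exact: orbit_sign.
have zS k : 2 * z k <= z (k + N.+3)%N.
  have -> : z (k + N.+3)%N = N.+3%:R * z k.+1 + N.+2%:R * z k.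
    rewrite /z orbit_rec // exprD -(signr_odd _ N.+3) odd3 exprS.
    by rewrite [N.+3%:R]mulrSr; ring.
  have := z0 k; have := z0 k.+1; have : (2 : R) <= N.+2%:R by rewrite ler_nat.
  have : (0 : R) < N.+3%:R by []. nra.
have zX j : j%:R * z 0%N <= z (j * N.+3)%N.
  have : 2 ^+ j * z 0%N <= z (j * N.+3)%N.
    elim: j => [|j IH]; first by rewrite mul1r.
    by rewrite mulSn addnC exprS; have := zS (j * N.+3)%N; lra.
  apply: le_trans; rewrite ler_pM2r // -natrX ler_nat.
  by apply: ltnW; exact: ltn_expl.
have [k kv] := archimedean_multiple `|v - p| (z0 0%N).
have [vl vr] : v - p <= `|v - p| /\ - (v - p) <= `|v - p|.
  by split; [exact: ler_norm|rewrite -normrN ler_norm].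
have z00 := z0 0%N.
split.
(* An even multiple of [n] lands above [p], an odd one below. The multiple is positive, so the
   iterate is a value of [g] at its predecessor. *)
- exists (iter (k.*2.+2 * N.+3).-1 g t); first exact: iter_I.
  rewrite -iterS prednK //; have := zX k.*2.+2.
  rewrite {2}/z -signr_odd oddM /= odd_double /= expr0 mul1r.
  have : k%:R * z 0%N <= k.*2.+2%:R * z 0%N by rewrite ler_pM2r // ler_nat; lia.
  lra.
- exists (iter (k.*2.+1 * N.+3).-1 g t); first exact: iter_I.
  rewrite -iterS prednK //; have := zX k.*2.+1.
  rewrite {2}/z -signr_odd oddM odd3 /= odd_double /= expr1.
  have : k%:R * z 0%N <= k.*2.+1%:R * z 0%N by rewrite ler_pM2r // ler_nat; lia.
  lra.
Qed.

Lemma decreasing_setT : I = setT.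
Proof.
apply/seteqP; split => // v _.
have [[x Ix vx] [y Iy yv]] := orbit_unbounded v.
by apply: (I_itv (g_I Iy) (g_I Ix)); rewrite vx yv.
Qed.

Let I_all t : I t. Proof. by rewrite decreasing_setT. Qed.

Let g_surj v : exists u, g u = v.
Proof.
have [[x Ix vx] [y Iy yv]] := orbit_unbounded v.
have IVT_xy a b : a <= b -> Num.min (g a) (g b) <= v <= Num.max (g a) (g b) ->
    exists u, g u = v.
  move=> ab ?; have [//||//|u _ <-] := @IVT _ g a b v; last by exists u.
  by apply: continuous_subspaceW (sub_itv _ _) g_cont; exact: I_all.
have [xy|yx] := leP x y; [apply: (IVT_xy _ _ xy)|apply: (IVT_xy _ _ (ltW yx))];
  by rewrite ge_min le_max vx yv !orbT.
Qed.

Lemma decreasing_affine : exists c, forall t, g t = neg_root R N.+3 * t + c.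
Proof.
have [r0 rE] := @neg_rootP R N.+3 isT decreasing_odd.
set r := neg_root R N.+3 in r0 rE *.
have [h gh] := choice g_surj.
have hp t : t != p -> h t != p.
  by apply: contra => /eqP hp; rewrite -(gh t) hp gp.
have hg t : h (g t) = t by apply: g_inj => //; exact: I_all.
(* The constant is forced by [g p = p]. *)
exists (p - r * p) => t; suff : g t - p = r * (t - p) by lra.
have [->|tp] := eqVneq t p; first by rewrite gp !subrr mulr0.
(* The backward orbit starts at [g t], so that its next term is [t] and the ratio of the first two
   terms gives the slope. *)
pose s k := iter k h (g t).
have iterK j x : iter j g (iter j h x) = x.
  by elim: j x => // j IH x; rewrite iterSr iterS gh IH.
(* This is the equation for [g] at the point [s (k + n)]. *)
have sE k : s k = N.+3%:R * s (k + N.+2)%N - N.+2%:R * s (k + N.+3)%N.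
  rewrite -[LHS](iterK N.+3) /s -iterD addnC (g_iter (I_all _)).
  by rewrite addnS iterS gh.
have gtp : g t != p by rewrite -[X in _ != X]gp; apply: contra tp => /eqP /g_inj ->.
have s_neq k : s k != p by elim: k => //= k; exact: hp.
have s_sign : forall k, 0 < (g t - p) * ((-1) ^+ k * (s k - p)).
  apply: (@alternating_sign _ (fun k => s k - p)) => k.
  rewrite -[X in (X - _) * _]gh mulrC; apply: cross; first exact: I_all.
  exact: (s_neq k.+1).
have nl : (- r) ^+ N.+3 = N.+3%:R * - r + N.+2%:R.
  rewrite exprNn -signr_odd decreasing_odd expr1 rE [N.+3%:R]mulrSr; ring.
have := @backward_geom _ N (- r) (fun k => (g t - p) * ((-1) ^+ k * (s k - p))).
move=> /(_ _ nl); rewrite oppr_gt0 => /(_ r0 (fun k => ltW (s_sign k))) /=.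
rewrite hg expr0 expr1 mul1r => H.
have gp0 : g t - p != 0 by rewrite subr_eq0.
suff E : (g t - p) * (g t - p) = (g t - p) * (r * (t - p)) by exact: (mulfI gp0 E).
rewrite H => [|k]; first by ring.
rewrite sE !exprD -(signr_odd _ N.+3) -(signr_odd _ N.+2) decreasing_odd.
have -> : odd N.+2 = false by apply/negbTE; exact: decreasing_odd.
by rewrite [N.+3%:R]mulrSr expr0 expr1; ring.
Qed.

End fixed_point.

Lemma decreasing_classification : [/\ odd N.+3, I = setT &
  exists c, forall t, g t = neg_root R N.+3 * t + c].
Proof.
have [p Ip gp] := fixpoint; split.
- exact: decreasing_odd gp.
- exact: decreasing_setT gp.
- exact: decreasing_affine gp.
Qed.

End decreasing.
End iterates.

Lemma iterates_classification {R : realType} (N : nat) (I : set R) (g : R -> R) :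
  is_interval I -> (exists x y, [/\ I x, I y & x < y]) ->
  set_fun I I g -> {within I, continuous g} ->
  (forall t, I t -> iter N.+3 g t = N.+3%:R * g t - N.+2%:R * t) ->
  (exists c, forall t, I t -> g t = t + c) \/
  [/\ odd N.+3, I = setT & exists c, forall t, g t = neg_root R N.+3 * t + c].
Proof.
move=> I_itv I_nondeg g_I g_cont g_iter.
have [mono|mono] := iterates_monotone I_itv g_cont g_iter; [left|right].
- exact: increasing_translation I_itv g_I g_cont g_iter mono.
- exact: decreasing_classification I_itv g_I g_cont g_iter I_nondeg mono.
Qed.

(** * Return to the multiplicative equation by conjugation with the exponential *)

Section multiplicative.
Context {R : realType}.
Implicit Types (J : set R) (f : R -> R).

Lemma within_continuous_ln_expR J f :
  (forall x, J x -> 0 < f x) -> {within J, continuous f} ->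
  {within @expR R @^-1` J, continuous (@ln R \o f \o expR)}.
Proof.
move=> f0 /subspace_continuousP f_cont; apply/subspace_continuousP => t Jt.
apply: (@cvg_comp _ _ _ (f \o expR) (@ln R) _ (nbhs (f (expR t)))); last first.
  by apply: continuous_ln; exact: f0.
apply: (@cvg_comp _ _ _ (@expR R) f _ (within J (nbhs (expR t)))
  _ _ (f_cont _ Jt)) => P.
rewrite /within /= => HP.
have := @continuous_expR R t _ HP.
by apply: (@filterS _ (nbhs t) _ (fun s => J (expR s) -> P (expR s))) => s H; exact: H.
Qed.

Lemma power_iterates_classification (n : nat) J f :
  (3 <= n)%N -> J `<=` `]0, +oo[%classic -> is_interval J ->
  (exists x y, [/\ J x, J y & x < y]) -> set_fun J J f ->
  {within J, continuous f} ->
  (forall x, J x -> iter n f x = f x ^+ n / x ^+ (n - 1)) ->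
  (exists c, 0 < c /\ forall x, J x -> f x = c * x) \/
  [/\ odd n, J = `]0, +oo[%classic &
    exists c, 0 < c /\ forall x, 0 < x -> f x = c * x `^ neg_root R n].
Proof.
case: n => [|[|[|N]]] // _ J0 J_itv J_nondeg f_J f_cont f_eq.
have {}J0 x : J x -> 0 < x by move=> /J0; rewrite /= in_itv /= andbT.
pose I := @expR R @^-1` J; pose g := @ln R \o f \o expR.
have g_exp t : I t -> expR (g t) = f (expR t).
  by move=> It; rewrite /g /= lnK // posrE; apply/J0/f_J.
have g_I : set_fun I I g by move=> t It; rewrite /I /= g_exp //; exact: f_J.
have iter_I k t : I t -> I (iter k g t) by move=> It; elim: k => //= k; exact: g_I.
have iter_exp k t : I t -> expR (iter k g t) = iter k f (expR t).
  by move=> It; elim: k => //= k <-; rewrite g_exp //; exact: iter_I.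
have lnI x : J x -> I (ln x) by move=> Jx; rewrite /I /= lnK // posrE J0.
have [|||||[c gE]|[nodd IT [c gE]]] := @iterates_classification R N I g.
- move=> x y Ix Iy z /andP[xz zy]; apply: J_itv Ix Iy _ _.
  by rewrite !ler_expR xz.
- have [x [y [Jx Jy xy]]] := J_nondeg; exists (ln x), (ln y); split; try exact: lnI.
  by rewrite ltr_ln ?posrE ?J0.
- exact: g_I.
- by apply: within_continuous_ln_expR f_cont => x /f_J /J0.
(* Exponentiation turns [n g(t) - (n - 1) t] into the quotient of powers in the original
   equation. *)
- move=> t It; apply: expR_inj; rewrite iter_exp // f_eq //.
  by rewrite expRB !expRM_natl g_exp // subn1.
- left; exists (expR c); split => [|x Jx]; first exact: expR_gt0.
  have /gE/(congr1 (@expR R)) := lnI _ Jx.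
  by rewrite (g_exp _ (lnI _ Jx)) expRD lnK ?posrE ?J0 // mulrC.
- right; split => //.
    apply/seteqP; split => x; rewrite /= in_itv /= andbT; first exact: J0.
    move=> x0; have : I (ln x) by rewrite IT.
    by rewrite /I /preimage /= lnK // posrE.
  exists (expR c); split => [|x x0]; first exact: expR_gt0.
  have /(congr1 (@expR R)) := gE (ln x).
  rewrite g_exp ?IT // expRD lnK ?posrE // mulrC => ->.
  by rewrite /powR gt_eqF.
Qed.

(** * Constraints on the slope of a linear self-map *)

Lemma expr_unbounded (c M : R) : 1 < c -> exists k, M < c ^+ k.
Proof.
move=> c1; have [k kM] : exists k, M < k%:R * (c - 1).
  by apply: archimedean_multiple; rewrite subr_gt0.
(* The induction proves the Bernoulli-type bound [k (c - 1) <= c ^ k]. *)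
exists k; apply: (lt_le_trans kM); elim: k {kM} => [|k IH]; first by rewrite mul0r.
have : 1 <= c ^+ k by rewrite exprn_ege1 // ltW.
by rewrite exprS [k.+1%:R]mulrSr; nra.
Qed.

(** Invariance puts every [c ^ k * x0] in [J]; these points escape to infinity if [c > 1]. *)
Lemma linear_bounded J f c x0 : J x0 -> 0 < x0 -> set_fun J J f ->
  (forall x, J x -> f x = c * x) -> bounded_set J -> c <= 1.
Proof.
move=> Jx0 x00 f_J fE bJ; rewrite leNgt; apply/negP => c1.
have Jc k : J (c ^+ k * x0).
  by elim: k => [|k IH]; rewrite ?mul1r // exprS -mulrA -fE //; exact: f_J.
have [M [_ /(_ (M + 1))]] := bJ; rewrite ltrDl => /(_ ltr01) HM.
have [k kM] := expr_unbounded ((M + 1) / x0) c1.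
have := HM _ (Jc k); rewrite /= leNgt => /negP; apply.
by apply: lt_le_trans (ler_norm _); rewrite -ltr_pdivrMr.
Qed.

(** The same points [c ^ k * x0] of [J] tend to 0 if [c < 1]. *)
Lemma linear_closure0 J f c x0 : J x0 -> 0 < x0 -> 0 < c -> set_fun J J f ->
  (forall x, J x -> f x = c * x) -> ~ closure J 0 -> 1 <= c.
Proof.
move=> Jx0 x00 c0 f_J fE J0; rewrite leNgt; apply/negP => c1; apply: J0.
have Jc k : J (c ^+ k * x0).
  by elim: k => [|k IH]; rewrite ?mul1r // exprS -mulrA -fE //; exact: f_J.
move=> B /nbhs_ballP[e /= e0 eB].
have [k kM] : exists k, x0 / e < c^-1 ^+ k.
  by apply: expr_unbounded; rewrite invf_gt1.
exists (c ^+ k * x0); split => //; apply: eB.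
have ck : 0 < c ^+ k by rewrite exprn_gt0.
rewrite /ball /= sub0r normrN gtr0_norm ?mulr_gt0 //.
by move: kM; rewrite exprVn ltr_pdivrMr // mulrC ltr_pdivlMr // mulrC.
Qed.

Lemma closure_pos0 : closure (`]0, +oo[%classic : set R) 0.
Proof.
move=> B /nbhs_ballP[e /= e0 eB]; exists (e / 2); split.
  by rewrite /= in_itv /= andbT divr_gt0.
apply: eB; rewrite /ball /= sub0r normrN gtr0_norm ?divr_gt0 //; lra.
Qed.

Lemma unbounded_pos : ~ bounded_set (`]0, +oo[%classic : set R).
Proof.
move=> [M [_ /(_ (`|M| + 1))]].
have MM := ler_norm M; have M0 := normr_ge0 M.
move=> /(_ ltac:(lra) (`|M| + 2)); rewrite /= in_itv /= andbT => H.
by have := H ltac:(lra); rewrite ger0_norm; lra.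
Qed.

End multiplicative.

(** * The five cases, read off from the classification *)

Theorem theorem5p7 (R : realType) (n : nat) (n_ge3 : (3 <= n)%N)
    (J : set R) (J_pos : J `<=` `]0, +oo[%classic) (J_itv : is_interval J)
    (J_nondeg : exists x y : R, [/\ J x, J y & x < y])
    (f : R -> R) (f_J : set_fun J J f) (f_cont : {within J, continuous f})
    (f_eq : forall x : R, J x -> iter n f x = f x ^+ n / x ^+ (n - 1)) :
  [/\ (bounded_set J -> ~ closure J 0 -> forall x : R, J x -> f x = x),
      (bounded_set J -> closure J 0 ->
        exists c : R, 0 < c <= 1 /\ forall x : R, J x -> f x = c * x),
      (~ bounded_set J -> ~ closure J 0 ->
        exists c : R, 1 <= c /\ forall x : R, J x -> f x = c * x),
      (J = `]0, +oo[%classic -> ~~ odd n ->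
        exists c : R, 0 < c /\ forall x : R, J x -> f x = c * x) &
      (J = `]0, +oo[%classic -> odd n ->
        exists c : R, 0 < c /\
          ((forall x : R, 0 < x -> f x = c * x) \/
           (forall x : R, 0 < x -> f x = c * x `^ neg_root R n)))].
Proof.
have [x0 [_ [Jx0 _ _]]] := J_nondeg.
have x00 : 0 < x0 by have := J_pos _ Jx0; rewrite /= in_itv /= andbT.
have := power_iterates_classification n_ge3 J_pos J_itv J_nondeg f_J f_cont f_eq.
case=> [[c [c0 fE]]|[nodd JE [c [c0 fE]]]]; split.
- move=> bJ J0 x Jx; rewrite fE //.
  have -> : c = 1; last by rewrite mul1r.
  apply/eqP; rewrite eq_le (linear_bounded Jx0 x00 f_J fE bJ).
  by rewrite (linear_closure0 Jx0 x00 c0 f_J fE J0).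
- move=> bJ _; exists c; split => //.
  by rewrite c0 (linear_bounded Jx0 x00 f_J fE bJ).
- move=> _ J0; exists c; split => //.
  exact: (linear_closure0 Jx0 x00 c0 f_J fE J0).
- by move=> _ _; exists c.
- move=> JE _; exists c; split => //; left => x x_gt0.
  by apply: fE; rewrite JE /= in_itv /= andbT.
(* In the power case [J] is the whole half-line, which is unbounded and adherent to 0, and [n] is
   odd; only the last clause can apply. *)
- by rewrite JE => /unbounded_pos.
- by rewrite JE => /unbounded_pos.
- by rewrite JE => _ /(_ closure_pos0).
- by rewrite nodd.
- by move=> _ _; exists c; split => //; right.
Qed.
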